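(* Assume periodic boundary conditions on $\partial\Omega$. Consider the first order semi-discrete (discrete in time, continuous in space) semi-implicit scheme for the shallow water equations $$\frac{\eta^{n+1}-\eta^n}{\Delta t}+\nabla\cdot\mathbf{q}^{n+1}=0,\qquad \frac{\mathbf{q}^{n+1}-\mathbf{q}^n}{\Delta t}+\nabla\cdot(\mathbf{v}^n\otimes\mathbf{q}^n)+gH^n\nabla\eta^{n+1}=\mathbf{0},$$ taken in its rescaled form with stiffness parameter $\varepsilon$ (given in the context). Then this scheme is a consistent approximation of the low Froude shallow water system $$\nabla\cdot\big((\eta_{(0)}-b)\,\mathbf{v}_{(0)}\big)=0,\qquad \partial_t\mathbf{q}_{(0)}+\nabla\cdot(\mathbf{v}_{(0)}\otimes\mathbf{q}_{(0)})+(\eta_{(0)}-b)\nabla\eta_{(2)}=\mathbf{0}$$ at the leading order asymptotic expansion in the asymptotic limit $\varepsilon\to0$.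
   Context: $\Omega\subset\mathbb{R}^2$ is the computational domain, $\eta$ is the free surface elevation, $b=b(\mathbf{x})$ the time-independent bottom bathymetry, $H=\eta-b>0$ the total water depth, $\mathbf{v}$ the velocity, $\mathbf{q}=H\mathbf{v}$ the discharge, $g$ the gravity acceleration, and $t^{n+1}=t^n+\Delta t$. The superscript $n$ denotes values at time $t^n$. Rescaling: in dimensionless variables the shallow water equations read $\partial_t\eta+\nabla\cdot\mathbf{q}=0$, $\partial_t\mathbf{q}+\nabla\cdot(\mathbf{v}\otimes\mathbf{q})+\frac{H}{\varepsilon^2}\nabla\eta=\mathbf{0}$, where the stiffness parameter $\varepsilon$ is the reference Froude number. The rescaled form of the scheme is obtained correspondingly, with $gH^n\nabla\eta^{n+1}$ replaced by $\frac{H^n}{\varepsilon^2}\nabla\eta^{n+1}$. Asymptotic expansion: a generic variable $\phi$ is expanded in powers of $\varepsilon$ (Chapman-Enskog expansion) as $\phi=\phi_{(0)}+\varepsilon\phi_{(1)}+\varepsilon^2\phi_{(2)}+\ldots$. The low Froude shallow water system is the limit model obtained by inserting this expansion into the rescaled continuous equations and collecting like powers of $\varepsilon$: with $H>0$, the relations at orders $\varepsilon^{-2}$ and $\varepsilon^{-1}$ make $\eta_{(0)}$ and $\eta_{(1)}$ functions of time only, the periodic boundary conditions and the integrated mass equation then make $\eta_{(0)}$ constant in time as well, and the relations at order $\varepsilon^0$ become the low Froude system, with $\mathbf{q}_{(0)}=(\eta_{(0)}-b)\mathbf{v}_{(0)}$. The property asserted is the asymptotic-preserving property: a numerical scheme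 satisfies it if it provides a consistent discretization of the asymptotic limit model of the governing equations.
   Formalization: For the first time step only, the limit relations are asserted when the initial leading order elevation is constant in space (well-prepared data); otherwise the discharge after that step is not divergence free at leading order. All later steps are unconditional. *)

(* Defs.v *)
From Stdlib Require Import Reals.
From Coquelicot Require Import Coquelicot.
Open Scope R_scope.

Inductive axis : Set := Ax1 | Ax2.

Definition field := R -> R -> R.
Definition vfield := axis -> field.

Definition partial (i : axis) (f : field) : field := fun x y =>
  match i with
  | Ax1 => Derive (fun s => f s y) x
  | Ax2 => Derive (fun s => f x s) y
  end.

Definition div (w : vfield) : field := fun x y =>
  partial Ax1 (w Ax1) x y + partial Ax2 (w Ax2) x y.

(* i-th component of div (v (x) q), i.e. the sum over j of d_j (v_i q_j).
   The tensor is symmetric when q = H v, so contracting over the other index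
   gives the same vector. *)
Definition div_tensor (v q : vfield) (i : axis) : field :=
  div (fun j x y => v i x y * q j x y).

(* Periodic boundary conditions: the domain is a rectangle of sides L1 and L2,
   and fields on it are identified with their periodic extensions to the plane. *)
Definition periodic (L1 L2 : R) (f : field) : Prop := forall x y,
  f (x + L1) y = f x y /\ f x (y + L2) = f x y.

Definition C1_field (f : field) : Prop := forall x y, ex_diff_n f 1 x y.

Definition spatially_constant (f : field) : Prop :=
  forall x y x' y', f x y = f x' y'.

(* u(eps) ~ a_0 + a_1 eps + a_2 eps^2 + ... as eps -> 0+, in the sense of
   Poincare. *)
Definition asymptotic_series (u : R -> R) (a : nat -> R) : Prop :=
  forall N : nat, exists C delta : R, 0 < delta /\
    forall eps, 0 < eps < delta ->
      Rabs (u eps - sum_n (fun k => a k * eps ^ k) N) <= C * eps ^ (S N).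

(* Expansion of a field in powers of eps that may be differentiated once term by
   term.  It is only required pointwise in space: a uniform expansion is a special
   case. *)
Definition expands (f : R -> field) (f_ : nat -> field) : Prop :=
  (forall k, C1_field (f_ k)) /\
  (forall x y, asymptotic_series (fun eps => f eps x y) (fun k => f_ k x y)) /\
  (forall i x y, asymptotic_series (fun eps => partial i (f eps) x y)
                                   (fun k => partial i (f_ k) x y)).

(* One step of the rescaled scheme, from (eta0, v0, q0) at time t^n to
   (eta1, q1) at time t^n + dt. *)
Definition scheme_step (b : field) (dt eps : R)
    (eta0 : field) (v0 q0 : vfield) (eta1 : field) (q1 : vfield) : Prop :=
  forall x y,
    (eta1 x y - eta0 x y) / dt + div q1 x y = 0 /\
    forall i,
      (q1 i x y - q0 i x y) / dt + div_tensor v0 q0 i x y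
      + (eta0 x y - b x y) / eps ^ 2 * partial i eta1 x y = 0.

(* N steps of the rescaled scheme, for all small eps, with every variable expanded
   in powers of eps.  [eta n eps] is the elevation at time t^n and [eta_ n k] the
   coefficient of eps^k in its expansion; likewise for v and q.  The depth is
   positive for each eps and also in the limit eps -> 0. *)
Record expanded_scheme_solution (L1 L2 : R) (b : field) (dt : R) (N : nat)
    (eta : nat -> R -> field) (v q : nat -> R -> vfield)
    (eta_ : nat -> nat -> field) (v_ q_ : nat -> nat -> vfield) : Prop := {
  ess_fields : exists eps0, 0 < eps0 /\ forall eps, 0 < eps < eps0 ->
    (forall n, (n <= N)%nat ->
      C1_field (eta n eps) /\ periodic L1 L2 (eta n eps) /\
      (forall i, C1_field (v n eps i) /\ periodic L1 L2 (v n eps i)) /\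
      (forall i, C1_field (q n eps i) /\ periodic L1 L2 (q n eps i)) /\
      (forall x y, 0 < eta n eps x y - b x y) /\
      (forall i x y, q n eps i x y = (eta n eps x y - b x y) * v n eps i x y)) /\
    (forall n, (n < N)%nat ->
      scheme_step b dt eps (eta n eps) (v n eps) (q n eps)
                           (eta (S n) eps) (q (S n) eps));
  ess_expansions : forall n, (n <= N)%nat ->
    expands (eta n) (eta_ n) /\
    (forall i, expands (fun eps => v n eps i) (fun k => v_ n k i)) /\
    (forall i, expands (fun eps => q n eps i) (fun k => q_ n k i));
  ess_depth : forall n, (n <= N)%nat -> forall x y, 0 < eta_ n 0%nat x y - b x y
}.

(* Left-hand sides of the leading order scheme; c is the constant leading order
   elevation, eta2 the elevation coefficient of order eps^2 at the new time. *)
Definition limit_mass (b : field) (c : R) (v1 : vfield) : field :=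
  div (fun i x y => (c - b x y) * v1 i x y).

Definition limit_momentum (b : field) (c dt : R) (v0 q0 q1 : vfield) (eta2 : field)
    (i : axis) : field := fun x y =>
  (q1 i x y - q0 i x y) / dt + div_tensor v0 q0 i x y
  + (c - b x y) * partial i eta2 x y.

(* The elevations at times t^1, ..., t^N come out of the scheme.  The data at time
   t^0 are arbitrary, so t^0 counts as a time of the low Froude regime only if
   eta_(0) is constant in space there. *)
Definition low_froude_time (eta_ : nat -> nat -> field) (n : nat) : Prop :=
  (0 < n)%nat \/ spatially_constant (eta_ 0%nat 0%nat).

Definition satisfies_limit_scheme (b : field) (dt : R) (N : nat)
    (eta_ : nat -> nat -> field) (v_ q_ : nat -> nat -> vfield) : Prop :=
  exists c : R,
    (forall n, (n <= N)%nat -> low_froude_time eta_ n ->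
      (forall x y, eta_ n 0%nat x y = c) /\
      (forall i x y, q_ n 0%nat i x y = (c - b x y) * v_ n 0%nat i x y)) /\
    (forall n, (0 < n <= N)%nat -> spatially_constant (eta_ n 1%nat)) /\
    (forall n, (n < N)%nat -> low_froude_time eta_ n -> forall x y,
      limit_mass b c (v_ (S n) 0%nat) x y = 0 /\
      forall i, limit_momentum b c dt (v_ n 0%nat) (q_ n 0%nat) (q_ (S n) 0%nat)
                  (eta_ (S n) 2%nat) i x y = 0).

Definition dtime (f : R -> field) : R -> field := fun t x y =>
  Derive (fun s => f s x y) t.

(* f is of class C^k jointly in (t, x, y) for ta < t < tb. *)
Fixpoint Ck_evol (k : nat) (ta tb : R) (f : R -> field) : Prop :=
  (forall t x y, ta < t < tb ->
     continuous (fun p : R * R * R => f (fst (fst p)) (snd (fst p)) (snd p)) (t, x, y)) /\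
  match k with
  | O => True
  | S k' =>
      (forall t x y, ta < t < tb ->
         ex_derive (fun s => f s x y) t /\
         ex_derive (fun s => f t s y) x /\
         ex_derive (fun s => f t x s) y) /\
      Ck_evol k' ta tb (dtime f) /\
      (forall i, Ck_evol k' ta tb (fun t => partial i (f t)))
  end.

(* Solution of class C^2 of the low Froude shallow water system for ta < t < tb,
   with constant elevation eta_(0) = c. *)
Record low_froude_solution (L1 L2 : R) (b : field) (ta tb c : R)
    (v q : R -> vfield) (eta2 : R -> field) : Prop := {
  lfs_regular : Ck_evol 2 ta tb eta2 /\
    forall i, Ck_evol 2 ta tb (fun t => v t i) /\ Ck_evol 2 ta tb (fun t => q t i);
  lfs_periodic : forall t, ta < t < tb -> periodic L1 L2 (eta2 t) /\
    forall i, periodic L1 L2 (v t i) /\ periodic L1 L2 (q t i);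
  lfs_depth : forall x y, 0 < c - b x y;
  lfs_discharge : forall t, ta < t < tb -> forall i x y,
    q t i x y = (c - b x y) * v t i x y;
  lfs_mass : forall t, ta < t < tb -> forall x y,
    div (fun i x y => (c - b x y) * v t i x y) x y = 0;
  lfs_momentum : forall t, ta < t < tb -> forall i x y,
    dtime (fun s => q s i) t x y + div_tensor (v t) (q t) i x y
    + (c - b x y) * partial i (eta2 t) x y = 0
}.

(* The truncation error of the leading order scheme on a solution of the low Froude
   system is O(dt), uniformly in space and on compact time intervals. *)
Definition limit_scheme_consistent (b : field) (ta tb c : R)
    (v q : R -> vfield) (eta2 : R -> field) : Prop :=
  forall t1 t2, ta < t1 -> t2 < tb ->
    exists C : R, forall t dt, 0 < dt -> t1 <= t -> t + dt <= t2 ->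
      forall x y,
        Rabs (limit_mass b c (v (t + dt)) x y) <= C * dt /\
        forall i, Rabs (limit_momentum b c dt (v t) (q t) (q (t + dt)) (eta2 (t + dt))
                          i x y) <= C * dt.

(* Main.v *)
(** Multiplying the momentum step by [eps ^ 2] and comparing leading terms order by
    order gives [(eta_(0) - b) grad eta_(0) = 0], [(eta_(0) - b) grad eta_(1) = 0] and
    then the limit momentum step. The mass step at order 0 says that [div q_(0)] is
    constant in space; on a periodic cell this constant is 0, so [eta_(0)] does not
    change in time and [div q_(0) = 0].

    For consistency, subtracting the momentum equation at time [t + dt] from the limit
    step leaves only increments in time of [dtime q] and [div_tensor v q], which are
    Lipschitz in time, uniformly in space by periodicity. *)

Require Import Defs.
From Stdlib Require Import Reals.
From Coquelicot Require Import Coquelicot.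
From Stdlib Require Import ZArith Lra Lia Classical ClassicalEpsilon.
Open Scope R_scope.

(** * One-sided asymptotics as [eps] tends to 0 from the right *)

Definition right_O (k : nat) (u : R -> R) : Prop :=
  exists C : R, at_right 0 (fun eps => Rabs (u eps) <= C * eps ^ k).

(** The value [a = 0] is allowed: this records the coefficient of [eps ^ k] once all lower
    coefficients vanish, not the exact order of [u]. *)
Definition leading (k : nat) (a : R) (u : R -> R) : Prop :=
  right_O (S k) (fun eps => u eps - a * eps ^ k).

Lemma at_right_0_pos : at_right 0 (fun eps => 0 < eps < 1).
Proof.
  exists (mkposreal 1 Rlt_0_1); intros eps H H0.
  unfold ball in H; simpl in H; unfold AbsRing_ball, abs, minus, plus, opp in H.
  simpl in H. split; [easy|]. apply Rabs_def2 in H; lra.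
Qed.

Lemma at_right_0_intro (P : R -> Prop) (d : R) :
  0 < d -> (forall eps, 0 < eps < d -> P eps) -> at_right 0 P.
Proof.
  intros Hd H. exists (mkposreal d Hd); intros eps He He0.
  unfold ball in He; simpl in He; unfold AbsRing_ball, abs, minus, plus, opp in He.
  simpl in He. apply H. split; [easy|]. apply Rabs_def2 in He; lra.
Qed.

Lemma at_right_0_imp2 (P Q S : R -> Prop) :
  (forall eps, 0 < eps < 1 -> P eps -> Q eps -> S eps) ->
  at_right 0 P -> at_right 0 Q -> at_right 0 S.
Proof.
  intros H HP HQ.
  apply (filter_imp (fun eps => (0 < eps < 1 /\ P eps) /\ Q eps)).
  - intros eps [[H1 H2] H3]; now apply H.
  - apply filter_and; [apply filter_and|]; auto using at_right_0_pos.
Qed.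

Lemma right_O_ext (k : nat) (u w : R -> R) :
  at_right 0 (fun eps => u eps = w eps) -> right_O k u -> right_O k w.
Proof.
  intros H [C HC]. exists C. revert H HC. apply at_right_0_imp2.
  intros eps _ E; now rewrite E.
Qed.

Lemma right_O_plus (k : nat) (u w : R -> R) :
  right_O k u -> right_O k w -> right_O k (fun eps => u eps + w eps).
Proof.
  intros [C HC] [D HD]. exists (C + D). revert HC HD. apply at_right_0_imp2.
  intros eps _ H1 H2. eapply Rle_trans; [apply Rabs_triang|lra].
Qed.

Lemma right_O_mult (k m : nat) (u w : R -> R) :
  right_O k u -> right_O m w -> right_O (k + m) (fun eps => u eps * w eps).
Proof.
  intros [C HC] [D HD]. exists (C * D). revert HC HD. apply at_right_0_imp2.
  intros eps _ H1 H2. rewrite Rabs_mult, pow_add.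
  replace (C * D * (eps ^ k * eps ^ m)) with (C * eps ^ k * (D * eps ^ m)) by ring.
  apply Rmult_le_compat; auto using Rabs_pos.
Qed.

Lemma right_O_monomial (k : nat) (a : R) : right_O k (fun eps => a * eps ^ k).
Proof.
  exists (Rabs a). generalize at_right_0_pos; apply filter_imp. intros eps [He _].
  rewrite Rabs_mult, (Rabs_pos_eq (eps ^ k)); [lra|apply pow_le; lra].
Qed.

Lemma right_O_weaken (k : nat) (u : R -> R) : right_O (S k) u -> right_O k u.
Proof.
  intros [C HC]. exists (Rabs C).
  revert HC; generalize at_right_0_pos; apply at_right_0_imp2. intros eps _ He HC.
  eapply Rle_trans; [apply HC|]. simpl.
  assert (0 < eps ^ k) by (apply pow_lt; lra).
  assert (H1 := Rle_abs C). assert (H2 := Rabs_pos C).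
  apply Rle_trans with (Rabs C * (eps * eps ^ k)).
  - apply Rmult_le_compat_r; [nra|easy].
  - apply Rmult_le_compat_l; [easy|nra].
Qed.

(** Cancelling [eps ^ k] leaves [Rabs a <= C * eps] for all small [eps > 0], which fails for [eps]
    below [Rabs a / (Rabs C + 1)] unless [a = 0]. *)
Lemma right_O_monomial_zero (k : nat) (a : R) :
  right_O (S k) (fun eps => a * eps ^ k) -> a = 0.
Proof.
  intros [C HC]. destruct (Req_dec a 0) as [|Ha]; [easy|exfalso].
  assert (HC' : at_right 0 (fun eps => Rabs a <= C * eps)).
  { revert HC; generalize at_right_0_pos; apply at_right_0_imp2. intros eps _ He H.
    assert (0 < eps ^ k) by (apply pow_lt; lra).
    rewrite Rabs_mult, (Rabs_pos_eq (eps ^ k)) in H by lra. simpl in H.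
    apply (Rmult_le_reg_r (eps ^ k)); [easy|]. lra. }
  apply Rabs_pos_lt in Ha.
  assert (Hd : 0 < Rabs a / (Rabs C + 1)).
  { apply Rdiv_lt_0_compat; [easy|]. assert (H := Rabs_pos C); lra. }
  destruct (filter_ex (F := at_right 0) _
    (filter_and _ _ HC' (filter_and _ _ at_right_0_pos
       (at_right_0_intro _ _ Hd (fun eps H => H))))) as [eps [H1 [H2 H3]]].
  assert (H4 := Rle_abs C). assert (H5 := Rabs_pos C).
  assert (H6 : eps * (Rabs C + 1) < Rabs a).
  { destruct H3 as [_ H3]. apply (Rmult_lt_compat_r (Rabs C + 1)) in H3; [|lra].
    unfold Rdiv in H3. rewrite Rmult_assoc, Rinv_l, Rmult_1_r in H3; lra. }
  nra.
Qed.

(** This turns an identity valid for each small [eps] into an identity between coefficients: both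
    sides are expanded and the coefficients compared. *)
Lemma leading_unique (k : nat) (a c : R) (u : R -> R) :
  leading k a u -> leading k c u -> a = c.
Proof.
  intros Ha Hc. enough (c - a = 0) by lra. apply (right_O_monomial_zero k).
  eapply right_O_ext; [|apply right_O_plus; [apply Ha|]].
  2: apply (right_O_mult 0 (S k) _ _ (right_O_monomial 0 (-1)) Hc).
  apply filter_forall; intros; simpl; ring.
Qed.

Lemma leading_ext (k : nat) (a : R) (u w : R -> R) :
  at_right 0 (fun eps => u eps = w eps) -> leading k a u -> leading k a w.
Proof.
  intros H. apply right_O_ext. revert H; apply filter_imp; intros eps H; now rewrite H.
Qed.

Lemma leading_monomial (k : nat) (a : R) : leading k a (fun eps => a * eps ^ k).
Proof.
  eapply right_O_ext; [|apply (right_O_monomial _ 0)].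
  apply filter_forall; intros; ring.
Qed.

Lemma leading_const (a : R) : leading 0 a (fun _ => a).
Proof.
  eapply leading_ext; [|apply leading_monomial].
  apply filter_forall; intros; simpl; ring.
Qed.

Lemma leading_plus (k : nat) (a c : R) (u w : R -> R) :
  leading k a u -> leading k c w -> leading k (a + c) (fun eps => u eps + w eps).
Proof.
  intros Ha Hc. eapply right_O_ext; [|apply right_O_plus; [apply Ha|apply Hc]].
  apply filter_forall; intros; simpl; ring.
Qed.

Lemma leading_O (k : nat) (a : R) (u : R -> R) : leading k a u -> right_O k u.
Proof.
  intros H. eapply right_O_ext;
    [|apply right_O_plus; [apply right_O_weaken, H|apply (right_O_monomial k a)]].
  apply filter_forall; intros; simpl; ring.
Qed.

(** The error splits as [(u - a * eps ^ k) * w + a * eps ^ k * (w - c * eps ^ m)], each summand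
    being of order [S (k + m)]. *)
Lemma leading_mult (k m : nat) (a c : R) (u w : R -> R) :
  leading k a u -> leading m c w -> leading (k + m) (a * c) (fun eps => u eps * w eps).
Proof.
  intros Ha Hc.
  eapply right_O_ext; [|apply right_O_plus;
    [apply (right_O_mult (S k) m); [apply Ha|apply (leading_O _ _ _ Hc)]|]].
  2:{ rewrite plus_n_Sm. apply right_O_mult; [apply (right_O_monomial k a)|apply Hc]. }
  apply filter_forall; intros; simpl.
  rewrite pow_add; ring.
Qed.

Lemma leading_scale (k : nat) (a c : R) (u : R -> R) :
  leading k a u -> leading k (c * a) (fun eps => c * u eps).
Proof. apply (leading_mult 0 k), leading_const. Qed.

(** Lets a term of higher order enter a comparison at order [k], where it contributes 0. *)
Lemma leading_weaken (k : nat) (a : R) (u : R -> R) :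
  leading (S k) a u -> leading k 0 u.
Proof.
  intros H. apply leading_O in H. revert H; apply right_O_ext.
  apply filter_forall; intros; ring.
Qed.

Lemma asymptotic_series_leading (u : R -> R) (a : nat -> R) (k : nat) :
  asymptotic_series u a -> (forall j, (j < k)%nat -> a j = 0) -> leading k (a k) u.
Proof.
  intros H Ha. destruct (H k) as [C [d [Hd HC]]]. exists C.
  apply (at_right_0_intro _ d Hd). intros eps He.
  replace (a k * eps ^ k) with (sum_n (fun j => a j * eps ^ j) k); [now apply HC|].
  destruct k as [|k]; [now rewrite sum_O|].
  rewrite sum_Sn. rewrite (sum_n_ext_loc _ (fun _ => 0)).
  - rewrite sum_n_const. unfold plus; simpl; ring.
  - intros j Hj. rewrite Ha by lia. apply Rmult_0_l.
Qed.

(** * Calculus of fields: product rule, vanishing gradients, divergence on a periodic cell *)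

Lemma C1_field_ex_derive (f : field) (x y : R) :
  C1_field f -> ex_derive (fun s => f s y) x /\ ex_derive (fun s => f x s) y.
Proof. intros H. destruct (H x y) as [_ [H1 [H2 _]]]. now split. Qed.

(** The product rule isolates [v], [q] and their first derivatives, the quantities whose expansions
    and Lipschitz bounds are at hand; none are given directly for derivatives of the products. *)
Lemma div_tensor_expand (v q : vfield) (i : axis) (x y : R) :
  (forall j, ex_derive (fun s => v j s y) x /\ ex_derive (fun s => v j x s) y) ->
  (forall j, ex_derive (fun s => q j s y) x /\ ex_derive (fun s => q j x s) y) ->
  div_tensor v q i x y =
    (partial Ax1 (v i) x y * q Ax1 x y + v i x y * partial Ax1 (q Ax1) x y) +
    (partial Ax2 (v i) x y * q Ax2 x y + v i x y * partial Ax2 (q Ax2) x y).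
Proof.
  intros Hv Hq. assert (Hi := Hv i). assert (H1 := Hq Ax1). assert (H2 := Hq Ax2).
  unfold div_tensor, div, partial.
  rewrite (Derive_mult (fun s => v i s y) (fun s => q Ax1 s y) x) by tauto.
  rewrite (Derive_mult (fun s => v i x s) (fun s => q Ax2 x s) y) by tauto.
  reflexivity.
Qed.

Lemma partial_ext (i : axis) (f g : field) (x y : R) :
  (forall s t, f s t = g s t) -> partial i f x y = partial i g x y.
Proof. intros H. destruct i; simpl; apply Derive_ext; auto. Qed.

Lemma eq_of_Derive_0 (f : R -> R) :
  (forall s, ex_derive f s) -> (forall s, Derive f s = 0) -> forall a b, f a = f b.
Proof.
  intros H H0.
  assert (Hlt : forall a b, a < b -> f a = f b).
  { intros a b. apply eq_is_derive. intros s _.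
    change zero with 0. rewrite <- (H0 s). now apply Derive_correct. }
  intros a b. destruct (Rtotal_order a b) as [h|[h|h]].
  - now apply Hlt.
  - now rewrite h.
  - symmetry; now apply Hlt.
Qed.

Lemma partial_0_spatially_constant (f : field) :
  C1_field f -> (forall i x y, partial i f x y = 0) -> spatially_constant f.
Proof.
  intros Hf H x y x' y'. transitivity (f x' y).
  - apply (eq_of_Derive_0 (fun s => f s y)); intros s.
    + now apply (C1_field_ex_derive f s y).
    + apply (H Ax1).
  - apply (eq_of_Derive_0 (fun s => f x' s)); intros s.
    + now apply (C1_field_ex_derive f x' s).
    + apply (H Ax2).
Qed.

Lemma continuity_2d_pt_sections (f : field) (x y : R) :
  continuity_2d_pt f x y ->
  continuous (fun s => f s y) x /\ continuous (fun s => f x s) y.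
Proof.
  intros H; split; apply continuity_pt_filterlim, continuity_pt_locally;
    intros e; destruct (H e) as [d Hd]; exists d; intros s Hs; apply Hd; try easy;
    rewrite Rminus_diag, Rabs_R0; apply cond_pos.
Qed.

(** Differentiation under the integral sign by [is_derive_RInt_param] takes the parameter first,
    while here the integration runs over the first coordinate. *)
Lemma continuity_2d_pt_swap (f : field) (x y : R) :
  continuity_2d_pt f x y -> continuity_2d_pt (fun u v => f v u) y x.
Proof.
  intros H e. destruct (H e) as [d Hd]. exists d. intros u v Hu Hv. now apply Hd.
Qed.

(* Averaging [div w = K] over a period in x shows that the flux of [w Ax2] through
   the horizontal line at height y has the constant derivative [K * L1]; being
   periodic in y, it is constant. *)
Lemma periodic_div_const_0 (L1 L2 K : R) (w : vfield) :
  0 < L1 -> 0 < L2 ->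
  (forall i, C1_field (w i)) -> (forall i, periodic L1 L2 (w i)) ->
  (forall x y, div w x y = K) -> K = 0.
Proof.
  intros HL1 HL2 HC Hp Hdiv.
  set (G := fun y => RInt (fun x => w Ax2 x y) 0 L1).
  assert (Hcont : forall y x, continuous (fun x => partial Ax1 (w Ax1) x y) x).
  { intros y x. destruct (HC Ax1 x y) as [_ [_ [_ [[H _] _]]]].
    apply (continuity_2d_pt_sections (partial Ax1 (w Ax1)) x y H). }
  assert (HI1 : forall y, RInt (fun x => partial Ax1 (w Ax1) x y) 0 L1 = 0).
  { intros y. unfold partial.
    rewrite (RInt_Derive (fun s => w Ax1 s y)).
    - destruct (Hp Ax1 0 y) as [H _]. rewrite Rplus_0_l in H. lra.
    - intros x _. now apply (C1_field_ex_derive (w Ax1) x y).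
    - intros x _. apply (Hcont y). }
  assert (HI2 : forall y, RInt (fun x => partial Ax2 (w Ax2) x y) 0 L1 = L1 * K).
  { intros y.
    assert (E : forall x, K - partial Ax1 (w Ax1) x y = partial Ax2 (w Ax2) x y).
    { intros x. rewrite <- (Hdiv x y). unfold div; ring. }
    apply is_RInt_unique.
    apply (is_RInt_ext (fun x => K - partial Ax1 (w Ax1) x y)); [now intros|].
    replace (L1 * K) with ((L1 - 0) * K - RInt (fun x => partial Ax1 (w Ax1) x y) 0 L1)
      by (rewrite HI1; ring).
    apply (is_RInt_minus (V := R_NormedModule)).
    - apply (is_RInt_const (V := R_NormedModule)).
    - apply (RInt_correct (V := R_CompleteNormedModule)).
      apply (ex_RInt_continuous (V := R_CompleteNormedModule)); intros x _.
      apply (Hcont y). }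
  assert (HG : forall y, is_derive G y (L1 * K)).
  { intros y. rewrite <- (HI2 y).
    apply (is_derive_RInt_param (fun y x => w Ax2 x y)).
    - apply filter_forall; intros y' x _. now apply (C1_field_ex_derive (w Ax2) x y').
    - intros x _. apply (continuity_2d_pt_swap (partial Ax2 (w Ax2))).
      now destruct (HC Ax2 x y) as [_ [_ [_ [_ [H _]]]]].
    - apply filter_forall; intros y'.
      apply (ex_RInt_continuous (V := R_CompleteNormedModule)); intros x _.
      apply (continuity_2d_pt_sections (w Ax2) x y'), HC. }
  destruct (MVT_gen G 0 L2 (fun _ => L1 * K)) as [c [_ Hc]].
  - intros; apply HG.
  - intros y _. apply continuity_pt_filterlim, (ex_derive_continuous (V := R_NormedModule)).
    eexists; apply HG.
  - assert (HG0 : G L2 = G 0).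
    { unfold G; apply RInt_ext; intros x _.
      destruct (Hp Ax2 x 0) as [_ H]. now rewrite Rplus_0_l in H. }
    assert (HK : (L1 * L2) * K = 0) by lra.
    destruct (Rmult_integral _ _ HK); [nra|easy].
Qed.

(** * Matching powers of [eps] in the scheme *)

(** [A] stands for the non-stiff terms, [H] for the old depth and [P] for a partial derivative of
    the new elevation. After multiplication by [eps ^ 2], [A] is silent at orders 0 and 1, so
    [h <> 0] forces [p 0] and then [p 1] to vanish; [A] enters at order 2. *)
Lemma stiff_balance (A H P : R -> R) (a h : R) (p : nat -> R) :
  h <> 0 -> leading 0 a A -> leading 0 h H -> asymptotic_series P p ->
  at_right 0 (fun eps => A eps + H eps / eps ^ 2 * P eps = 0) ->
  p 0%nat = 0 /\ p 1%nat = 0 /\ a + h * p 2%nat = 0.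
Proof.
  intros Hh HA HH HP E.
  assert (HA2 : leading 2 a (fun eps => A eps * eps ^ 2)).
  { rewrite <- (Rmult_1_r a). apply (leading_mult 0 2); [easy|].
    eapply leading_ext; [|apply (leading_monomial 2 1)].
    apply filter_forall; intros; ring. }
  assert (HA1 := leading_weaken _ _ _ HA2). assert (HA0 := leading_weaken _ _ _ HA1).
  (* Order [k] can be read off only when all lower [p j] vanish, so this is applied successively for
     [k] equal to 0, 1 and 2. *)
  assert (Hsum : forall k c, leading k c (fun eps => A eps * eps ^ 2) ->
    (forall j, (j < k)%nat -> p j = 0) -> c + h * p k = 0).
  { intros k c Hc Hj.
    assert (HHP := leading_mult 0 k _ _ _ _ HH (asymptotic_series_leading _ _ _ HP Hj)).
    assert (HS := leading_plus _ _ _ _ _ Hc HHP).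
    apply (leading_unique _ _ 0 _ HS). eapply leading_ext; [|apply (leading_monomial k 0)].
    revert E; generalize at_right_0_pos; apply at_right_0_imp2; intros eps _ He E.
    replace (A eps * eps ^ 2 + H eps * P eps)
      with (eps ^ 2 * (A eps + H eps / eps ^ 2 * P eps)) by (field; lra).
    rewrite E; ring. }
  assert (H0 : p 0%nat = 0).
  { assert (H0 := Hsum 0%nat 0 HA0 ltac:(lia)). rewrite Rplus_0_l in H0.
    destruct (Rmult_integral _ _ H0); easy. }
  assert (H1 : p 1%nat = 0).
  { assert (H1 := Hsum 1%nat 0 HA1). rewrite Rplus_0_l in H1.
    destruct (Rmult_integral h (p 1%nat)); [apply H1|easy|easy].
    intros j Hj; now replace j with 0%nat by lia. }
  repeat split; try easy. apply Hsum; [easy|].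
  intros [|[|j]] Hj; try easy; lia.
Qed.

Lemma expands_leading (f : R -> field) (f_ : nat -> field) (x y : R) :
  expands f f_ -> leading 0 (f_ 0%nat x y) (fun eps => f eps x y).
Proof.
  intros [_ [H _]].
  apply (asymptotic_series_leading _ (fun k => f_ k x y)); [easy|lia].
Qed.

Lemma expands_partial_leading (f : R -> field) (f_ : nat -> field) (i : axis) (x y : R) :
  expands f f_ -> leading 0 (partial i (f_ 0%nat) x y) (fun eps => partial i (f eps) x y).
Proof.
  intros [_ [_ H]].
  apply (asymptotic_series_leading _ (fun k => partial i (f_ k) x y)); [apply H|lia].
Qed.

(** The values at a point and at its translate are the same function of [eps], hence have the same
    leading coefficient. *)
Lemma expands_periodic (L1 L2 : R) (f : R -> field) (f_ : nat -> field) :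
  expands f f_ -> at_right 0 (fun eps => periodic L1 L2 (f eps)) ->
  periodic L1 L2 (f_ 0%nat).
Proof.
  intros Hf Hp x y. split.
  - apply (leading_unique 0 _ _ (fun eps => f eps x y)); [|now apply expands_leading].
    eapply leading_ext; [|apply expands_leading, Hf].
    revert Hp; apply filter_imp; intros eps H; apply H.
  - apply (leading_unique 0 _ _ (fun eps => f eps x y)); [|now apply expands_leading].
    eapply leading_ext; [|apply expands_leading, Hf].
    revert Hp; apply filter_imp; intros eps H; apply H.
Qed.

Lemma div_tensor_leading (v q : R -> vfield) (v_ q_ : nat -> vfield) (i : axis) (x y : R) :
  (forall j, expands (fun eps => v eps j) (fun k => v_ k j)) ->
  (forall j, expands (fun eps => q eps j) (fun k => q_ k j)) ->
  at_right 0 (fun eps => forall j, C1_field (v eps j) /\ C1_field (q eps j)) ->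
  leading 0 (div_tensor (v_ 0%nat) (q_ 0%nat) i x y)
            (fun eps => div_tensor (v eps) (q eps) i x y).
Proof.
  intros Hv Hq HC.
  rewrite div_tensor_expand by (intros j; apply C1_field_ex_derive; apply Hv || apply Hq).
  apply (leading_ext 0 _ (fun eps =>
    (partial Ax1 (v eps i) x y * q eps Ax1 x y + v eps i x y * partial Ax1 (q eps Ax1) x y) +
    (partial Ax2 (v eps i) x y * q eps Ax2 x y + v eps i x y * partial Ax2 (q eps Ax2) x y))).
  { revert HC; apply filter_imp; intros eps HC. symmetry; apply div_tensor_expand;
      intros j; apply C1_field_ex_derive, HC. }
  assert (Hterm : forall j, leading 0
    (partial j (v_ 0%nat i) x y * q_ 0%nat j x y + v_ 0%nat i x y * partial j (q_ 0%nat j) x y)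
    (fun eps => partial j (v eps i) x y * q eps j x y
                + v eps i x y * partial j (q eps j) x y)).
  { intros j. apply leading_plus; apply (leading_mult 0 0).
    - apply (expands_partial_leading _ _ _ _ _ (Hv i)).
    - apply (expands_leading _ _ _ _ (Hq j)).
    - apply (expands_leading _ _ _ _ (Hv i)).
    - apply (expands_partial_leading _ _ _ _ _ (Hq j)). }
  now apply leading_plus.
Qed.

Lemma div_leading (q : R -> vfield) (q_ : nat -> vfield) (x y : R) :
  (forall j, expands (fun eps => q eps j) (fun k => q_ k j)) ->
  leading 0 (div (q_ 0%nat) x y) (fun eps => div (q eps) x y).
Proof.
  intros H. apply leading_plus.
  - apply (expands_partial_leading _ _ _ _ _ (H Ax1)).
  - apply (expands_partial_leading _ _ _ _ _ (H Ax2)).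
Qed.

Lemma difference_quotient_leading (dt : R) (f g : R -> field) (f_ g_ : nat -> field) (x y : R) :
  expands f f_ -> expands g g_ ->
  leading 0 ((g_ 0%nat x y - f_ 0%nat x y) / dt) (fun eps => (g eps x y - f eps x y) / dt).
Proof.
  intros Hf Hg.
  replace ((g_ 0%nat x y - f_ 0%nat x y) / dt)
    with (/ dt * (g_ 0%nat x y + -1 * f_ 0%nat x y)) by (unfold Rdiv; ring).
  eapply leading_ext; [|apply leading_scale, leading_plus, leading_scale;
    apply expands_leading; [apply Hg|apply Hf]].
  apply filter_forall; intros; unfold Rdiv; ring.
Qed.

(** * Leading order relations satisfied by an expanded solution of the scheme *)

Section Expanded_solution.

Context (L1 L2 : R) (HL1 : 0 < L1) (HL2 : 0 < L2) (b : field) (dt : R) (Hdt : 0 < dt) (N : nat)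
  (eta : nat -> R -> field) (v q : nat -> R -> vfield)
  (eta_ : nat -> nat -> field) (v_ q_ : nat -> nat -> vfield)
  (Hsol : expanded_scheme_solution L1 L2 b dt N eta v q eta_ v_ q_).

Lemma expanded_fields (n : nat) : (n <= N)%nat -> at_right 0 (fun eps =>
  (forall i, C1_field (v n eps i) /\ C1_field (q n eps i) /\ periodic L1 L2 (q n eps i)) /\
  (forall i x y, q n eps i x y = (eta n eps x y - b x y) * v n eps i x y)).
Proof.
  intros Hn. destruct (ess_fields _ _ _ _ _ _ _ _ _ _ _ Hsol) as [e [He H]].
  apply (at_right_0_intro _ e He). intros eps Heps.
  destruct (H eps Heps) as [H1 _]. destruct (H1 n Hn) as (_ & _ & Hv & Hq & _ & Hd).
  split; [|easy]. intros i. split; [apply Hv|apply Hq].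
Qed.

Lemma expanded_step (n : nat) : (n < N)%nat -> at_right 0 (fun eps =>
  scheme_step b dt eps (eta n eps) (v n eps) (q n eps) (eta (S n) eps) (q (S n) eps)).
Proof.
  intros Hn. destruct (ess_fields _ _ _ _ _ _ _ _ _ _ _ Hsol) as [e [He H]].
  apply (at_right_0_intro _ e He). intros eps Heps. now apply H.
Qed.

Lemma depth_leading (n : nat) (x y : R) : (n <= N)%nat ->
  leading 0 (eta_ n 0%nat x y - b x y) (fun eps => eta n eps x y - b x y).
Proof.
  intros Hn. apply leading_plus; [|apply leading_const].
  apply expands_leading, (ess_expansions _ _ _ _ _ _ _ _ _ _ _ Hsol n Hn).
Qed.

Lemma limit_discharge (n : nat) (i : axis) (x y : R) : (n <= N)%nat ->
  q_ n 0%nat i x y = (eta_ n 0%nat x y - b x y) * v_ n 0%nat i x y.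
Proof.
  intros Hn. destruct (ess_expansions _ _ _ _ _ _ _ _ _ _ _ Hsol n Hn) as (_ & Hv & Hq).
  apply (leading_unique 0 _ _ (fun eps => q n eps i x y)).
  - apply (expands_leading _ _ _ _ (Hq i)).
  - eapply leading_ext; [|apply (leading_mult 0 0); [apply depth_leading, Hn|
      apply (expands_leading _ _ _ _ (Hv i))]].
    generalize (expanded_fields n Hn); apply filter_imp; intros eps [_ H].
    symmetry; apply H.
Qed.

Lemma momentum_orders (n : nat) (i : axis) (x y : R) : (n < N)%nat ->
  partial i (eta_ (S n) 0%nat) x y = 0 /\
  partial i (eta_ (S n) 1%nat) x y = 0 /\
  (q_ (S n) 0%nat i x y - q_ n 0%nat i x y) / dt
    + div_tensor (v_ n 0%nat) (q_ n 0%nat) i x y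
    + (eta_ n 0%nat x y - b x y) * partial i (eta_ (S n) 2%nat) x y = 0.
Proof.
  intros Hn. assert (Hle : (n <= N)%nat) by lia.
  destruct (ess_expansions _ _ _ _ _ _ _ _ _ _ _ Hsol n Hle) as (_ & Hv & Hq).
  destruct (ess_expansions _ _ _ _ _ _ _ _ _ _ _ Hsol (S n) Hn) as (He1 & _ & Hq1).
  eapply (stiff_balance _ _ _ _ _ (fun k => partial i (eta_ (S n) k) x y)).
  - assert (H := ess_depth _ _ _ _ _ _ _ _ _ _ _ Hsol n Hle x y). lra.
  - apply leading_plus.
    + apply (difference_quotient_leading dt _ _ _ _ x y (Hq i) (Hq1 i)).
    + apply (div_tensor_leading (v n) (q n)); [easy|easy|].
      generalize (expanded_fields n Hle); apply filter_imp; intros eps [H _] j.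
      split; apply H.
  - apply (depth_leading n x y Hle).
  - apply He1.
  - generalize (expanded_step n Hn); apply filter_imp; intros eps H. apply (H x y).
Qed.

(** The stiff gradient acts on the new elevation, so the step ending at [n] gives the claim; no step
    ends at time index 0. *)
Lemma new_elevation_constant (n : nat) : (0 < n <= N)%nat ->
  spatially_constant (eta_ n 0%nat) /\ spatially_constant (eta_ n 1%nat).
Proof.
  intros Hn. destruct n as [|n]; [lia|].
  destruct (ess_expansions _ _ _ _ _ _ _ _ _ _ _ Hsol (S n) ltac:(lia)) as ((H & _) & _).
  split; (apply partial_0_spatially_constant; [apply H|]);
    intros i x y; apply momentum_orders; lia.
Qed.

Lemma mass_order_0 (n : nat) (x y : R) : (n < N)%nat ->
  (eta_ (S n) 0%nat x y - eta_ n 0%nat x y) / dt + div (q_ (S n) 0%nat) x y = 0.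
Proof.
  intros Hn.
  destruct (ess_expansions _ _ _ _ _ _ _ _ _ _ _ Hsol n ltac:(lia)) as (He & _).
  destruct (ess_expansions _ _ _ _ _ _ _ _ _ _ _ Hsol (S n) Hn) as (He1 & _ & Hq1).
  apply (leading_unique 0 _ _ (fun eps =>
    (eta (S n) eps x y - eta n eps x y) / dt + div (q (S n) eps) x y)).
  - apply leading_plus.
    + now apply difference_quotient_leading.
    + now apply div_leading.
  - eapply leading_ext; [|apply leading_const].
    generalize (expanded_step n Hn); apply filter_imp; intros eps H.
    symmetry; apply (H x y).
Qed.

(** With both leading elevations constant in space, the mass step prescribes the same divergence of
    the new discharge everywhere, and periodicity makes it 0. *)
Lemma elevation_step (n : nat) (x y : R) : (n < N)%nat ->
  spatially_constant (eta_ n 0%nat) -> eta_ (S n) 0%nat x y = eta_ n 0%nat x y.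
Proof.
  intros Hn Hc.
  destruct (new_elevation_constant (S n) ltac:(lia)) as [Hc1 _].
  destruct (ess_expansions _ _ _ _ _ _ _ _ _ _ _ Hsol (S n) Hn) as (_ & _ & Hq1).
  (* The left-hand side is the constant value of the divergence. *)
  assert (HK : - ((eta_ (S n) 0%nat x y - eta_ n 0%nat x y) / dt) = 0).
  { apply (periodic_div_const_0 L1 L2 _ (q_ (S n) 0%nat)); try easy.
    - intros i; apply Hq1.
    - intros i. apply (expands_periodic _ _ _ _ (Hq1 i)).
      generalize (expanded_fields (S n) Hn); apply filter_imp; intros eps H. apply H.
    - intros x' y'. assert (H := mass_order_0 n x' y' Hn).
      rewrite (Hc1 x' y' x y), (Hc x' y' x y) in H. lra. }
  apply (f_equal (fun r => r * dt)) in HK. field_simplify in HK; lra.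
Qed.

(** The induction starts at index 1, since the initial leading elevation may vary in space. *)
Lemma elevation_const (n : nat) (x y x' y' : R) : (0 < n <= N)%nat ->
  eta_ n 0%nat x y = eta_ 1%nat 0%nat x' y'.
Proof.
  induction n as [|[|n] IH]; intros Hn; [lia| |].
  - now apply new_elevation_constant.
  - rewrite elevation_step; [apply IH; lia|lia|].
    apply new_elevation_constant; lia.
Qed.

Lemma limit_scheme : satisfies_limit_scheme b dt N eta_ v_ q_.
Proof.
  (* For [N > 0] the reference value is taken at index 1, where the elevation is constant whatever
     the initial data; for [N = 0] only index 0 exists. *)
  exists (eta_ (Nat.min 1 N) 0%nat 0 0).
  set (c := eta_ _ _ _ _).
  assert (Hc : forall n, (n <= N)%nat -> low_froude_time eta_ n ->
    forall x y, eta_ n 0%nat x y = c).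
  { intros n Hn Hlow x y. unfold c. destruct (Nat.eq_dec n 0) as [->|Hn0].
    - destruct Hlow as [Hlow|Hlow]; [lia|]. rewrite (Hlow x y 0 0).
      destruct (Nat.eq_dec N 0) as [HN|HN].
      + now replace (Nat.min 1 N) with 0%nat by lia.
      + replace (Nat.min 1 N) with 1%nat by lia.
        symmetry; apply elevation_step; [lia|easy].
    - replace (Nat.min 1 N) with 1%nat by lia. apply elevation_const; lia. }
  repeat split.
  - now apply Hc.
  - intros i x y. rewrite limit_discharge by easy. now rewrite Hc.
  - intros n Hn. now apply new_elevation_constant.
  - assert (Hm := mass_order_0 n x y H).
    rewrite (Hc n), (Hc (S n)) in Hm; [|lia|left; lia|lia|easy].
    (* The limit discharge relation holds at all points, so it may be used under the derivatives to
       replace [(c - b) * v] by [q]. *)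
    transitivity (div (q_ (S n) 0%nat) x y); [|].
    + unfold limit_mass, div. f_equal; apply partial_ext; intros s t;
        rewrite limit_discharge by lia; rewrite (Hc (S n)); [easy|lia|left; lia|
          easy|lia|left; lia].
    + unfold Rdiv in Hm. rewrite Rminus_diag, Rmult_0_l in Hm. lra.
  (* The scheme weights the new gradient by the old depth, so [c] is traded for the elevation at
     index [n]. *)
  - intros i. unfold limit_momentum. rewrite <- (Hc n ltac:(lia) H0 x y).
    now apply momentum_orders.
Qed.

End Expanded_solution.

(** * Uniform bounds and Lipschitz estimates in time for periodic evolving fields *)

Lemma periodic_representative (L : R) (g : R -> R) (x : R) :
  0 < L -> (forall s, g (s + L) = g s) -> exists x', 0 <= x' <= L /\ g x = g x'.
Proof.
  intros HL Hg.
  assert (Hn : forall n s, g (s + INR n * L) = g s).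
  { induction n as [|n IH]; intros s.
    - simpl. f_equal; ring.
    - rewrite S_INR, <- (IH s), <- (Hg (s + INR n * L)). f_equal; ring. }
  set (z := Int_part (x / L)). exists (x - IZR z * L). split.
  - destruct (base_Int_part (x / L)) as [H1 H2]. fold z in H1, H2.
    assert (Hx : x = x / L * L) by (field; lra). split; nra.
  (* [Hn] adds a natural number of periods, so the sign of [z] decides which of the two points is
     shifted onto the other. *)
  - destruct (Z.le_gt_cases 0 z) as [Hz|Hz].
    + rewrite <- (Hn (Z.to_nat z) (x - _)). rewrite INR_IZR_INZ, Z2Nat.id by lia.
      f_equal; ring.
    + rewrite <- (Hn (Z.to_nat (- z)) x). rewrite INR_IZR_INZ, Z2Nat.id by lia.
      rewrite opp_IZR. f_equal; ring.
Qed.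

Definition evol_continuous (ta tb : R) (f : R -> field) : Prop :=
  forall t x y, ta < t < tb ->
    continuous (fun p : R * R * R => f (fst (fst p)) (snd (fst p)) (snd p)) (t, x, y).

Definition evol_bounded (t1 t2 : R) (f : R -> field) : Prop :=
  exists M, forall t x y, t1 <= t <= t2 -> Rabs (f t x y) <= M.

Definition evol_periodic (L1 L2 ta tb : R) (f : R -> field) : Prop :=
  forall t, ta < t < tb -> periodic L1 L2 (f t).

(* The radius at p is chosen below 1/|f| near p, so the uniform lower bound on radii
   given by [compactness_value] is also a bound on f. *)
Lemma evol_continuous_bounded_box (ta tb t1 t2 a1 b1 a2 b2 : R) (f : R -> field) :
  ta < t1 -> t2 < tb -> evol_continuous ta tb f ->
  exists M, forall t x y,
    t1 <= t <= t2 -> a1 <= x <= b1 -> a2 <= y <= b2 -> Rabs (f t x y) <= M.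
Proof.
  intros Ht1 Ht2 Hf.
  (* Points are nested tuples ending in [unit], as [compactness_value] requires. The radius must be
     defined at every point, so the time constraint is a premise and the radius 1 serves where it
     fails. *)
  assert (Hloc : forall p : R * (R * (R * unit)), exists d : posreal,
    let '(t, (x, (y, _))) := p in t1 <= t <= t2 ->
    forall t' x' y', Rabs (t' - t) < d -> Rabs (x' - x) < d -> Rabs (y' - y) < d ->
      Rabs (f t' x' y') <= / d).
  { intros [t [x [y u]]].
    destruct (classic (t1 <= t <= t2)) as [Ht|Ht]; [|now exists (mkposreal 1 Rlt_0_1)].
    assert (Hc := Hf t x y ltac:(lra)).
    destruct (proj1 (filterlim_locally (F := locally (t, x, y)) _ _) Hc
                (mkposreal 1 Rlt_0_1)) as [d Hd]. cbn [fst snd] in Hd.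
    assert (HA := Rabs_pos (f t x y)).
    set (r := / (Rabs (f t x y) + 1)).
    assert (Hr : 0 < r) by (apply Rinv_0_lt_compat; lra).
    assert (Hm : 0 < Rmin d r) by (apply Rmin_glb_lt; [apply cond_pos|easy]).
    exists (mkposreal _ Hm). intros _ t' x' y' H1 H2 H3. cbn [pos] in *.
    assert (Hml := Rmin_l d r). assert (Hmr := Rmin_r d r).
    assert (Hball : Rabs (f t' x' y' - f t x y) < 1).
    { apply (Hd (t', x', y')). repeat split;
        cbn [fst snd]; unfold ball; simpl; unfold AbsRing_ball, abs, minus, plus, opp; simpl;
        eapply Rlt_le_trans; eassumption. }
    apply Rle_trans with (Rabs (f t x y) + 1).
    - replace (f t' x' y') with (f t x y + (f t' x' y' - f t x y)) by ring.
      eapply Rle_trans; [apply Rabs_triang|lra].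
    - rewrite <- (Rinv_inv (Rabs (f t x y) + 1)). fold r. now apply Rinv_le_contravar. }
  set (delta := fun p => proj1_sig (constructive_indefinite_description _ (Hloc p))).
  destruct (compactness_value 3 (t1, (a1, (a2, tt))) (t2, (b1, (b2, tt))) delta) as [d Hd].
  (* [compactness_value] yields its nearby centre only under a double negation, hence the argument
     by contradiction. *)
  exists (/ d). intros t x y Ht Hx Hy. apply NNPP. intros Hnot.
  apply (Hd (t, (x, (y, tt)))); [now repeat split|].
  intros [[t' [x' [y' []]]] [Hb [Hc Hle]]]. apply Hnot.
  revert Hc Hle. unfold delta. destruct (constructive_indefinite_description _ _) as [e He].
  simpl. intros (H1 & H2 & H3 & _) Hle.
  destruct Hb as [Hb _].
  apply Rle_trans with (/ e); [now apply He|].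
  apply Rinv_le_contravar; [apply cond_pos|easy].
Qed.

Lemma evol_continuous_bounded (L1 L2 ta tb t1 t2 : R) (f : R -> field) :
  0 < L1 -> 0 < L2 -> ta < t1 -> t2 < tb ->
  evol_continuous ta tb f -> evol_periodic L1 L2 ta tb f -> evol_bounded t1 t2 f.
Proof.
  intros HL1 HL2 Ht1 Ht2 Hf Hp.
  destruct (evol_continuous_bounded_box ta tb t1 t2 0 L1 0 L2 f) as [M HM]; try easy.
  exists M. intros t x y Ht.
  destruct (periodic_representative L1 (fun s => f t s y) x HL1) as [x' [Hx' ->]].
  { intros s. apply Hp. lra. }
  destruct (periodic_representative L2 (fun s => f t x' s) y HL2) as [y' [Hy' ->]].
  { intros s. apply Hp. lra. }
  now apply HM.
Qed.

(** Both sides have the same difference quotient at every increment, and [Derive] is a limit of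
    these quotients. *)
Lemma Derive_shift (f : R -> R) (a x : R) :
  Derive f (x + a) = Derive (fun s => f (s + a)) x.
Proof.
  unfold Derive. f_equal. apply Lim_ext. intros h.
  now replace (x + h + a) with (x + a + h) by ring.
Qed.

Lemma periodic_partial (L1 L2 : R) (f : field) (i : axis) :
  periodic L1 L2 f -> periodic L1 L2 (partial i f).
Proof.
  intros Hp x y. destruct i; simpl; split;
    rewrite ?(Derive_shift (fun s => f s y)), ?(Derive_shift (fun s => f x s));
    apply Derive_ext; intros s; apply Hp.
Qed.

Lemma evol_periodic_dtime (L1 L2 ta tb : R) (f : R -> field) :
  evol_periodic L1 L2 ta tb f -> evol_periodic L1 L2 ta tb (dtime f).
Proof.
  intros Hp t Ht x y.
  (* Periodicity is known only for times in the open interval, so the time derivatives are compared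
     through local equality near [t]. *)
  assert (Hloc : locally t (fun s => ta < s < tb)) by now apply (locally_interval _ _ ta tb).
  split; apply Derive_ext_loc; revert Hloc; apply filter_imp; intros s Hs;
    now apply Hp.
Qed.

Definition evol_lipschitz (t1 t2 : R) (f : R -> field) : Prop :=
  exists M, forall s t x y, t1 <= s <= t2 -> t1 <= t <= t2 ->
    Rabs (f t x y - f s x y) <= M * Rabs (t - s).

Lemma MVT_time (f : R -> field) (s t x y : R) :
  (forall r, Rmin s t <= r <= Rmax s t -> ex_derive (fun r => f r x y) r) ->
  exists r, Rmin s t <= r <= Rmax s t /\ f t x y - f s x y = dtime f r x y * (t - s).
Proof.
  intros H. apply (MVT_gen (fun r => f r x y)).
  - intros r Hr. apply Derive_correct, H. lra.
  - intros r Hr. apply continuity_pt_filterlim.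
    now apply (ex_derive_continuous (V := R_NormedModule) (fun r => f r x y)), H.
Qed.

Lemma Rmin_Rmax_between (t1 t2 s t r : R) :
  t1 <= s <= t2 -> t1 <= t <= t2 -> Rmin s t <= r <= Rmax s t -> t1 <= r <= t2.
Proof. unfold Rmin, Rmax. destruct (Rle_dec s t); lra. Qed.

(** By the mean value theorem in time, a bound on [dtime f] is a Lipschitz constant; that bound
    comes from continuity and periodicity, as does the one on [f]. *)
Lemma Ck_evol_1_bounded_lipschitz (L1 L2 ta tb t1 t2 : R) (f : R -> field) :
  0 < L1 -> 0 < L2 -> ta < t1 -> t2 < tb ->
  Ck_evol 1 ta tb f -> evol_periodic L1 L2 ta tb f ->
  evol_bounded t1 t2 f /\ evol_lipschitz t1 t2 f.
Proof.
  intros HL1 HL2 Ht1 Ht2 [Hf [Hd [[Hdt _] _]]] Hp.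
  split; [now apply (evol_continuous_bounded L1 L2 ta tb)|].
  destruct (evol_continuous_bounded L1 L2 ta tb t1 t2 (dtime f)) as [M HM]; try easy.
  { now apply evol_periodic_dtime. }
  exists M. intros s t x y Hs Ht.
  destruct (MVT_time f s t x y) as [r [Hr ->]].
  - intros r Hr. assert (H := Rmin_Rmax_between t1 t2 s t r Hs Ht Hr).
    apply (Hd r x y); lra.
  - rewrite Rabs_mult. apply Rmult_le_compat_r; [apply Rabs_pos|].
    apply HM. now apply (Rmin_Rmax_between t1 t2 s t).
Qed.

Lemma Ck_evol_weaken (k : nat) (ta tb : R) (f : R -> field) :
  Ck_evol (S k) ta tb f -> Ck_evol k ta tb f.
Proof.
  revert f; induction k as [|k IH]; intros f [Hf [Hd [Hdt Hdx]]].
  - now split.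
  - split; [easy|]. split; [easy|]. split; [now apply IH|].
    intros i. apply IH, Hdx.
Qed.

Lemma evol_lipschitz_plus (t1 t2 : R) (f g : R -> field) :
  evol_lipschitz t1 t2 f -> evol_lipschitz t1 t2 g ->
  evol_lipschitz t1 t2 (fun t x y => f t x y + g t x y).
Proof.
  intros [A HA] [B HB]. exists (A + B). intros s t x y Hs Ht.
  replace (f t x y + g t x y - (f s x y + g s x y))
    with ((f t x y - f s x y) + (g t x y - g s x y)) by ring.
  eapply Rle_trans; [apply Rabs_triang|].
  specialize (HA s t x y Hs Ht). specialize (HB s t x y Hs Ht). lra.
Qed.

(** The increment is split as [(f t - f s) * g t + f s * (g t - g s)]; the bounds on [g] and [f]
    absorb the undifferenced factors. *)
Lemma evol_lipschitz_mult (t1 t2 : R) (f g : R -> field) :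
  evol_bounded t1 t2 f /\ evol_lipschitz t1 t2 f ->
  evol_bounded t1 t2 g /\ evol_lipschitz t1 t2 g ->
  evol_lipschitz t1 t2 (fun t x y => f t x y * g t x y).
Proof.
  intros [[A HA] [A' HA']] [[B HB] [B' HB']]. exists (A' * B + A * B').
  intros s t x y Hs Ht.
  replace (f t x y * g t x y - f s x y * g s x y)
    with ((f t x y - f s x y) * g t x y + f s x y * (g t x y - g s x y)) by ring.
  eapply Rle_trans; [apply Rabs_triang|]. rewrite !Rabs_mult.
  replace ((A' * B + A * B') * Rabs (t - s))
    with (A' * Rabs (t - s) * B + A * (B' * Rabs (t - s))) by ring.
  apply Rplus_le_compat; apply Rmult_le_compat; auto using Rabs_pos.
Qed.

(* Only the product [(c - b) * grad eta2] is controlled, since nothing bounds [b]: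
   the momentum equation at the new time trades it for [dtime q] and the flux. *)
Lemma low_froude_momentum_consistent (L1 L2 : R) (b : field) (ta tb c : R)
    (v q : R -> vfield) (eta2 : R -> field) (t1 t2 : R) (i : axis) :
  0 < L1 -> 0 < L2 -> low_froude_solution L1 L2 b ta tb c v q eta2 ->
  ta < t1 -> t2 < tb ->
  exists C, forall t dt, 0 < dt -> t1 <= t -> t + dt <= t2 -> forall x y,
    Rabs (limit_momentum b c dt (v t) (q t) (q (t + dt)) (eta2 (t + dt)) i x y) <= C * dt.
Proof.
  intros HL1 HL2 [[_ Hreg] Hper _ _ _ Hmom] Ht1 Ht2.
  assert (Hpv : forall j, evol_periodic L1 L2 ta tb (fun t => v t j)).
  { intros j t Ht. now apply Hper. }
  assert (Hpq : forall j, evol_periodic L1 L2 ta tb (fun t => q t j)).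
  { intros j t Ht. now apply Hper. }
  (* Class C^2 is spent here: the first space derivatives occurring in the flux are still C^1, hence
     Lipschitz in time. *)
  assert (Hlip : forall f, Ck_evol 2 ta tb f -> evol_periodic L1 L2 ta tb f ->
    (evol_bounded t1 t2 f /\ evol_lipschitz t1 t2 f) /\
    (forall j, evol_bounded t1 t2 (fun t => partial j (f t)) /\
               evol_lipschitz t1 t2 (fun t => partial j (f t)))).
  { intros f Hf Hp. split.
    - apply (Ck_evol_1_bounded_lipschitz L1 L2 ta tb); try easy.
      now apply Ck_evol_weaken.
    - destruct Hf as [_ [_ [_ Hdx]]].
      intros j. apply (Ck_evol_1_bounded_lipschitz L1 L2 ta tb); try easy.
      intros t Ht. apply periodic_partial, Hp, Ht. }
  assert (Hterm : forall j, evol_lipschitz t1 t2 (fun t x y =>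
    partial j (v t i) x y * q t j x y + v t i x y * partial j (q t j) x y)).
  { intros j. destruct (Hlip _ (proj1 (Hreg i)) (Hpv i)) as [Hv Hv'].
    destruct (Hlip _ (proj2 (Hreg j)) (Hpq j)) as [Hq Hq'].
    apply evol_lipschitz_plus.
    - apply (evol_lipschitz_mult _ _ (fun t => partial j (v t i)) (fun t => q t j));
        [apply Hv'|apply Hq].
    - apply (evol_lipschitz_mult _ _ (fun t => v t i) (fun t => partial j (q t j)));
        [apply Hv|apply Hq']. }
  destruct (evol_lipschitz_plus _ _ _ _ (Hterm Ax1) (Hterm Ax2)) as [A HA].
  assert (HD : forall t x y, t1 <= t <= t2 -> div_tensor (v t) (q t) i x y =
    (partial Ax1 (v t i) x y * q t Ax1 x y + v t i x y * partial Ax1 (q t Ax1) x y) +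
    (partial Ax2 (v t i) x y * q t Ax2 x y + v t i x y * partial Ax2 (q t Ax2) x y)).
  { intros t x y Ht. apply div_tensor_expand; intros j.
    - destruct (proj1 (Hreg j)) as [_ [H _]]. apply (H t x y). lra.
    - destruct (proj2 (Hreg j)) as [_ [H _]]. apply (H t x y). lra. }
  destruct (proj2 (Hreg i)) as [_ [Hdq [Hdtq _]]].
  destruct (Ck_evol_1_bounded_lipschitz L1 L2 ta tb t1 t2 (dtime (fun t => q t i)))
    as [_ [B HB]]; try easy.
  { now apply evol_periodic_dtime. }
  (* [B] and [A] are Lipschitz constants of [dtime q] and of the flux. The intermediate time [r] is
     only within [dt] of [t + dt], which calls for [Rabs B]; the flux increment spans exactly
     [dt]. *)
  exists (Rabs B + A). intros t dt Hdt Ht Htdt x y. unfold limit_momentum.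
  assert (Hm := Hmom (t + dt) ltac:(lra) i x y).
  destruct (MVT_time (fun t => q t i) t (t + dt) x y) as [r [Hr Hq]].
  { intros r Hr. rewrite Rmin_left, Rmax_right in Hr by lra. apply (Hdq r x y); lra. }
  rewrite Rmin_left, Rmax_right in Hr by lra.
  replace ((q (t + dt) i x y - q t i x y) / dt) with (dtime (fun t => q t i) r x y)
    by (rewrite Hq; field; lra).
  (* Subtracting [Hm], the momentum equation at the new time, cancels the term in [eta2]. *)
  replace (_ + _) with
    ((dtime (fun t => q t i) r x y - dtime (fun t => q t i) (t + dt) x y)
     - (div_tensor (v (t + dt)) (q (t + dt)) i x y - div_tensor (v t) (q t) i x y)) by lra.
  eapply Rle_trans; [apply Rabs_triang|]. rewrite Rabs_Ropp.
  rewrite Rmult_plus_distr_r. apply Rplus_le_compat.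
  - eapply Rle_trans; [apply HB; lra|].
    apply Rle_trans with (Rabs B * Rabs (r - (t + dt))).
    + apply Rmult_le_compat_r; [apply Rabs_pos|apply Rle_abs].
    + apply Rmult_le_compat_l; [apply Rabs_pos|].
      rewrite Rabs_left1; lra.
  - rewrite !HD by lra. eapply Rle_trans; [apply HA; lra|].
    replace (t + dt - t) with dt by ring. rewrite (Rabs_pos_eq dt); lra.
Qed.

Theorem theorem4 (L1 L2 : R) (HL1 : 0 < L1) (HL2 : 0 < L2)
    (b : field) (Hb : periodic L1 L2 b) :
  (forall (dt : R) (N : nat)
          (eta : nat -> R -> field) (v q : nat -> R -> vfield)
          (eta_ : nat -> nat -> field) (v_ q_ : nat -> nat -> vfield),
     0 < dt ->
     expanded_scheme_solution L1 L2 b dt N eta v q eta_ v_ q_ ->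
     satisfies_limit_scheme b dt N eta_ v_ q_)
  /\
  (forall (ta tb c : R) (v q : R -> vfield) (eta2 : R -> field),
     low_froude_solution L1 L2 b ta tb c v q eta2 ->
     limit_scheme_consistent b ta tb c v q eta2).
Proof.
  split.
  - intros dt N eta v q eta_ v_ q_ Hdt Hsol.
    now apply (limit_scheme L1 L2 HL1 HL2 b dt Hdt N eta v q).
  - intros ta tb c v q eta2 Hsol t1 t2 Ht1 Ht2.
    assert (HC := fun i => low_froude_momentum_consistent L1 L2 b ta tb c v q eta2 t1 t2 i
                             HL1 HL2 Hsol Ht1 Ht2).
    destruct (HC Ax1) as [C1 HC1]. destruct (HC Ax2) as [C2 HC2].
    assert (HC1' := Rabs_pos C1). assert (HC2' := Rabs_pos C2).
    (* The absolute values make the sum dominate both component constants and be nonnegative, as the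
       bound on the zero mass residual demands. *)
    exists (Rabs C1 + Rabs C2). intros t dt Hdt Ht Htdt x y. split.
    + unfold limit_mass. rewrite (lfs_mass _ _ _ _ _ _ _ _ _ Hsol) by lra.
      rewrite Rabs_R0. nra.
    + intros [|]; (eapply Rle_trans; [apply HC1 || apply HC2; easy|]);
        apply Rmult_le_compat_r; try lra.
      * assert (H := Rle_abs C1). lra.
      * assert (H := Rle_abs C2). lra.
Qed.
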